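(* Let $(X,\mathbb{A},d)$ be a $C^{\ast}$-algebra valued metric space and let $C_{x_0,r}^{C^{\ast}}$ be any circle on $X$ (with $x_0\in X$, $r\in\mathbb{A}_+$). Define $\varphi:X\to\mathbb{A}_+$ by $\varphi(x)=d(x,x_0)$ for all $x\in X$. Let $T:X\to X$ be a self-mapping for which there is some $B\in\mathbb{A}$ with $\|B\|<1$ such that $$d(x,Tx)\preceq \varphi(x)-\varphi(Tx)\qquad\text{and}\qquad r\preceq B^{\ast}d(x,Tx)B+d(Tx,x_0)$$ for all $x\in C_{x_0,r}^{C^{\ast}}$. If $T$ satisfies the following contraction condition: for some $A\in\mathbb{A}$ with $\|A\|<1$ and for all $x\in C_{x_0,r}^{C^{\ast}}$, $y\in X\setminus C_{x_0,r}^{C^{\ast}}$, there exists $$u(x,y)\in\left\{d(x,y),\,d(x,Tx),\,d(y,Ty),\,d(x,Ty),\,d(y,Tx)\right\}$$ such that $$d(Tx,Ty)\preceq A^{\ast}u(x,y)A,$$ then the circle $C_{x_0,r}^{C^{\ast}}$ is the unique fixed circle of $T$.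
   Context: $\mathbb{A}$ is a unital $C^{\ast}$-algebra with unit $I$ and zero element $\theta$. $\mathbb{A}_h=\{a\in\mathbb{A}: a=a^{\ast}\}$. An element $a\in\mathbb{A}$ is positive, written $\theta\preceq a$, if $a\in\mathbb{A}_h$ and its spectrum is contained in $[0,\infty)$; $\mathbb{A}_+$ is the set of positive elements (so $\theta\in\mathbb{A}_+$). For $a,b\in\mathbb{A}_h$, $a\preceq b$ means $b-a\in\mathbb{A}_+$. A $C^{\ast}$-algebra valued metric space $(X,\mathbb{A},d)$ is a nonempty set $X$ with a map $d:X\times X\to\mathbb{A}$ such that for all $x,y,z\in X$: (i) $\theta\preceq d(x,y)$, and $d(x,y)=\theta$ if and only if $x=y$; (ii) $d(x,y)=d(y,x)$; (iii) $d(x,y)\preceq d(x,z)+d(z,y)$. For $x_0\in X$ and $r\in\mathbb{A}_+$, the circle with center $x_0$ and radius $r$ is $C_{x_0,r}^{C^{\ast}}=\{x\in X: d(x,x_0)=r\}$. For a self-mapping $T:X\to X$, the circle $C_{x_0,r}^{C^{\ast}}$ is called a fixed circle of $T$ if $Tx=x$ for all $x\in C_{x_0,r}^{C^{\ast}}$. The element $A$ in the contraction condition is the same for all $x,y$.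
   Formalization: Literal uniqueness is false (each fixed point p gives a fixed circle of center p and radius θ; an empty circle makes the conditions vacuous), so it is stated as: the circle is fixed and, if it is nonempty, every fixed circle of T is contained in it. *)

(* Defs.v *)
(* MathComp-Analysis, with the complex numbers R[i] of mathcomp-real-closed. *)
From HB Require Import structures.
From mathcomp Require Import all_boot all_order all_algebra.
From mathcomp Require Import complex.
From mathcomp Require Import all_classical all_reals all_analysis.

Set Implicit Arguments.
Unset Strict Implicit.
Unset Printing Implicit Defensive.

Import Order.TTheory GRing.Theory Num.Theory.
Import numFieldNormedType.Exports.

Local Open Scope classical_set_scope.
Local Open Scope ring_scope.
Local Open Scope complex_scope.

(* The norm is an operation of its own, with values in R: the library has no
   join of its algebra and normed-module hierarchies, so `|a| is not available
   on an algType.  An algType has 1 != 0, so the zero algebra is excluded. *)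
HB.mixin Record isCStarAlgebra (R : realType) A & GRing.Algebra R[i] A := {
  cnorm : A -> R;
  star : A -> A;
  cnorm_eq0 : forall a : A, cnorm a = 0 -> a = 0;
  cnormD : forall a b : A, cnorm (a + b) <= cnorm a + cnorm b;
  cnormZ : forall (l : R[i]) (a : A),
    cnorm (l *: a) = ComplexField.Normc.normc l * cnorm a;
  cnormM : forall a b : A, cnorm (a * b) <= cnorm a * cnorm b;
  cnorm_complete : forall u : nat -> A,
    (forall e : R, 0 < e -> exists N : nat, forall m n : nat,
       (N <= m)%N -> (N <= n)%N -> cnorm (u m - u n) < e) ->
    exists l : A, cnorm (u n - l) @[n --> \oo] --> (0 : R);
  starK : forall a : A, star (star a) = a;
  starD : forall a b : A, star (a + b) = star a + star b;
  starZ : forall (l : R[i]) (a : A), star (l *: a) = conjc l *: star a;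
  starM : forall a b : A, star (a * b) = star b * star a;
  cstar_identity : forall a : A, cnorm (star a * a) = cnorm a ^+ 2
}.

#[short(type="cstarAlgType")]
HB.structure Definition CStarAlgebra (R : realType) :=
  {A of GRing.Algebra R[i] A & isCStarAlgebra R A}.

Section CStarOrder.
Variables (R : realType) (A : cstarAlgType R).
Implicit Types a b : A.

Definition selfadjoint a : Prop := star a = a.

Definition invertible a : Prop := exists b, a * b = 1 /\ b * a = 1.

Definition spectrum a : set R[i] := [set l | ~ invertible (a - l%:A)].

(* In R[i], 0 <= l means that l is real and nonnegative. *)
Definition cpos a : Prop := selfadjoint a /\ spectrum a `<=` [set l | 0 <= l].

Definition cle a b : Prop := [/\ selfadjoint a, selfadjoint b & cpos (b - a)].

End CStarOrder.

Notation "a '⪯' b" := (cle a b) (at level 70, no associativity) : ring_scope.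

Section CStarMetric.
Variables (R : realType) (A : cstarAlgType R) (X : Type).

(* Nonemptiness of X is not recorded here: circles come with a center. *)
Record cstar_metric (d : X -> X -> A) : Prop := CStarMetric {
  cmetric_pos : forall x y, cpos (d x y);
  cmetric_eq0 : forall x y, d x y = 0 <-> x = y;
  cmetric_sym : forall x y, d x y = d y x;
  cmetric_triangle : forall x y z, d x y ⪯ d x z + d z y
}.

Variables (d : X -> X -> A) (T : X -> X).

Definition circle (x0 : X) (r : A) : set X := [set x | d x x0 = r].

(* An empty circle is fixed, and so is every circle contained in a fixed one:
   in particular circle x 0 = [set x] for each fixed point x.  So at most an
   inclusion-largest fixed circle can be unique, and "circle x0 r is the unique
   fixed circle" is to be read, for circle x0 r nonempty, as: every fixed
   circle is contained in circle x0 r. *)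
Definition fixed_circle (x0 : X) (r : A) : Prop :=
  forall x, circle x0 r x -> T x = x.

End CStarMetric.

(* Main.v *)
Require Import Defs.
From mathcomp Require Import all_boot all_order all_algebra.
From mathcomp Require Import complex.
From mathcomp Require Import all_classical all_reals all_analysis.
From mathcomp Require Import ring lra.

(** At a point x of the circle the two hypotheses add up to
    p + q1 + q2 = b^* p b, where p = d(x, Tx) and q1, q2 are the two positive
    differences.  If the norm is monotone on positive elements, then
    |p| <= |b|^2 |p|, so p = 0 and x is fixed.  For two fixed points x and y, x
    on the circle and y off it, each of the five choices of u is either d(x, y)
    or 0, so the contraction condition reads d(x, y) <= a^* d(x, y) a or
    d(x, y) <= 0; the same argument (with a = 0 in the second case) forces
    x = y, which is absurd.  Both parts thus rest on [contraction_eq0].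

    Positivity is a condition on the spectrum, so monotonicity of the norm
    ([cnorm_le_add]) is where the theory of C*-algebras enters.  It is derived
    from one fact, [selfadjoint_spectrum_norm]: a self-adjoint h has |h| or -|h|
    in its spectrum.  Given this, a positive p satisfies | |p| - p | <= |p|, and
    the condition | t - a | <= t for some t is visibly stable under sums and
    bounds the real spectrum of a from below by 0.  Applied to
    |p + q| - p = (|p + q| - (p + q)) + q, it shows that the spectral value |p|
    of p is at most |p + q|.

    The fact itself is proved without holomorphic functions, by Rickart's
    elementary argument for the spectral radius formula.  Let |h| = 1 and
    suppose that 1 - h and 1 + h are invertible.  Arens' trick of shifting h by
    an imaginary scalar bounds the resolvent of h off the real axis, so the
    inverses of 1 - w h are bounded uniformly over the unit circle, and for x
    close to 1 they are uniformly close to those of 1 - x w h.  Since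
    2 (1 - w^2 h^2)^-1 = (1 - w h)^-1 + (1 + w h)^-1, this closeness passes from
    (h, x) to (h^2, x^2) without loss.  After many squarings x^N is nearly 0, so
    (1 - h^N)^-1 is nearly 1 and h^N is small, whereas the C*-identity keeps
    |h^N| = 1 for N a power of 2. *)

Set Implicit Arguments.
Unset Strict Implicit.
Unset Printing Implicit Defensive.

Import Order.TTheory GRing.Theory Num.Theory.
Import numFieldNormedType.Exports.
Local Open Scope classical_set_scope.
Local Open Scope ring_scope.
Local Open Scope complex_scope.

Local Notation normc := ComplexField.Normc.normc.

(** * The norm and bounded inverses *)

Section Norm.
Variables (R : realType) (A : cstarAlgType R).
Implicit Types (a b e : A) (l : R[i]) (x M N : R).

Lemma normc_real x : normc x%:C = `|x|.
Proof. by rewrite /= expr0n addr0 sqrtr_sqr. Qed.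

Lemma normc_ge0 l : 0 <= normc l.
Proof. by case: l => x y; exact: sqrtr_ge0. Qed.

Lemma cnorm0 : cnorm (0 : A) = 0.
Proof. by rewrite -(scale0r (0 : A)) cnormZ ComplexField.Normc.normc0 mul0r. Qed.

Lemma cnormN a : cnorm (- a) = cnorm a.
Proof.
by rewrite -scaleN1r cnormZ normcN ComplexField.Normc.normc1 mul1r.
Qed.

Lemma cnorm_ge0 a : 0 <= cnorm a.
Proof. by have := cnormD a (- a); rewrite subrr cnorm0 cnormN; lra. Qed.

Lemma cnorm_gt0 a : a <> 0 -> 0 < cnorm a.
Proof.
move=> a0; rewrite lt_neqAle cnorm_ge0 andbT; apply/eqP => h.
by apply: a0; apply: cnorm_eq0.
Qed.

Lemma cnormB a b : cnorm (a - b) <= cnorm a + cnorm b.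
Proof. by rewrite -(cnormN b); exact: cnormD. Qed.

Lemma cnormZr x a : cnorm (x%:C *: a) = `|x| * cnorm a.
Proof. by rewrite cnormZ normc_real. Qed.

Lemma star1 : star (1 : A) = 1.
Proof. by have := starM (star (1 : A)) 1; rewrite !mulr1 !starK mulr1 => <-. Qed.

Lemma cnorm1 : cnorm (1 : A) = 1.
Proof.
have := cstar_identity (1 : A); rewrite star1 mulr1.
have n0 : cnorm (1 : A) != 0.
  by apply/eqP => /cnorm_eq0/eqP; rewrite oner_eq0.
by move=> h; apply: (mulfI n0); rewrite mulr1 -expr2 -h.
Qed.

Lemma cnorm_scalar l : cnorm (l%:A : A) = normc l.
Proof. by rewrite cnormZ cnorm1 mulr1. Qed.

Lemma cnormX a n : cnorm (a ^+ n) <= cnorm a ^+ n.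
Proof.
elim: n => [|n IH]; first by rewrite !expr0 cnorm1.
rewrite !exprS; apply: le_trans (cnormM _ _) _.
by apply: ler_wpM2l => //; exact: cnorm_ge0.
Qed.

(** The bound M is part of the notion because inverses of 1 - w h are to be
    bounded uniformly in w over the unit circle. *)
Definition bounded_inverse a M :=
  exists b, [/\ a * b = 1, b * a = 1 & cnorm b <= M].


(** Neumann series: the partial sums of the geometric series are a Cauchy
    sequence, and their limit y satisfies y = 1 + a y, whence the bound. *)
Lemma neumann a : cnorm a < 1 -> bounded_inverse (1 - a) (1 - cnorm a)^-1.
Proof.
set k := cnorm a => k1.
have k0 : 0 <= k by exact: cnorm_ge0.
have k1' : 0 < 1 - k by rewrite subr_gt0.
pose S n := \sum_(i < n) a ^+ i.
have dist n j : (1 - k) * cnorm (S (n + j)%N - S n) <= k ^+ n - k ^+ (n + j).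
  elim: j => [|j IH]; first by rewrite addn0 !subrr cnorm0 mulr0.
  rewrite addnS /S big_ord_recr /= addrAC.
  apply: le_trans (ler_wpM2l (ltW k1') (cnormD _ _)) _.
  rewrite mulrDr.
  have := ler_wpM2l (ltW k1') (cnormX a (n + j)).
  by rewrite -/k exprS; move: IH; rewrite -/(S _) -/(S _); nra.
have kX : (fun n => k ^+ n) @ \oo --> (0 : R).
  by apply: cvg_expr; rewrite ger0_norm.
have [y hy] : exists y : A, cnorm (S n - y) @[n --> \oo] --> (0 : R).
  apply: cnorm_complete => e e0.
  have /cvgr0Pnorm_lt /(_ _ (mulr_gt0 k1' e0)) [N _ hN] := kX.
  have aux m n : (N <= n)%N -> (n <= m)%N -> cnorm (S m - S n) < e.
    move=> Nn nm; rewrite -(ltr_pM2l k1').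
    have := dist n (m - n)%N; rewrite subnKC // => /le_lt_trans; apply.
    apply: le_lt_trans (hN n Nn); rewrite /= ger0_norm ?exprn_ge0 //.
    by rewrite gerBl exprn_ge0.
  exists N => m n Nm Nn; have [nm|mn] := leqP n m; first exact: aux.
  by rewrite -cnormN opprB; apply: aux => //; exact: ltnW.
have limit0 (c : R) b : (forall n, cnorm b <= c * cnorm (S n - y) + k ^+ n) -> b = 0.
  move=> hb; apply: cnorm_eq0; apply/eqP; rewrite eq_le cnorm_ge0 andbT.
  have hc : (fun n => c * cnorm (S n - y) + k ^+ n) @ \oo --> (0 : R).
    rewrite [X in _ --> X](_ : 0 = c * 0 + 0); last by rewrite mulr0 addr0.
    by apply: cvgD kX; apply: cvgMr hy.
  apply: (ler_cvg_to (cvg_cst (cnorm b)) hc).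
  by apply: nearW.
have tel n : (1 - a) * S n = 1 - a ^+ n.
  by rewrite -(opprB a 1) mulNr -subrX1 opprB.
have tel' n : S n * (1 - a) = 1 - a ^+ n.
  rewrite -tel mulrBr mulrBl mulr1 mul1r; congr (_ - _).
  by rewrite /S mulr_suml mulr_sumr; apply: eq_bigr => i _; rewrite -exprSr exprS.
have yr : (1 - a) * y = 1.
  apply/eqP; rewrite -subr_eq0; apply/eqP; apply: (limit0 (cnorm (1 - a))) => n.
  have -> : (1 - a) * y - 1 = - ((1 - a) * (S n - y)) - a ^+ n.
    by rewrite mulrBr tel opprB -[RHS]addrA (opprB 1) [in RHS]addrAC subrr sub0r.
  apply: le_trans (cnormB _ _) _; rewrite cnormN.
  by apply: lerD (cnormM _ _) (cnormX _ _).
have yl : y * (1 - a) = 1.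
  apply/eqP; rewrite -subr_eq0; apply/eqP; apply: (limit0 (cnorm (1 - a))) => n.
  have -> : y * (1 - a) - 1 = - ((S n - y) * (1 - a)) - a ^+ n.
    by rewrite mulrBl tel' opprB -[RHS]addrA (opprB 1) [in RHS]addrAC subrr sub0r.
  apply: le_trans (cnormB _ _) _; rewrite cnormN mulrC.
  by rewrite mulrC [X in _ <= X + _]mulrC; apply: lerD (cnormM _ _) (cnormX _ _).
exists y; split => //.
rewrite -[leRHS]mulr1 ler_pdivlMl // mulrBl mul1r lerBlDr.
have {1}-> : y = 1 + a * y by move: yr; rewrite mulrBl mul1r => /eqP; rewrite subr_eq => /eqP.
by apply: le_trans (cnormD _ _) _; rewrite cnorm1 lerD2l; exact: cnormM.
Qed.

Lemma bounded_inverse_mul a b M N :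
  bounded_inverse a M -> bounded_inverse b N -> bounded_inverse (a * b) (M * N).
Proof.
move=> [a' [aa' a'a nM]] [b' [bb' b'b nN]]; exists (b' * a'); split.
- by rewrite mulrA -(mulrA a) bb' mulr1.
- by rewrite mulrA -(mulrA b') a'a mulr1.
- apply: le_trans (cnormM _ _) _; rewrite mulrC.
  by apply: ler_pM => //; exact: cnorm_ge0.
Qed.

Lemma bounded_inverse_scale l a M :
  l != 0 -> bounded_inverse a M -> bounded_inverse (l *: a) ((normc l)^-1 * M).
Proof.
move=> l0 [a' [aa' a'a nM]]; exists (l^-1 *: a'); split.
- by rewrite -scalerAl -scalerAr aa' scalerA divff // scale1r.
- by rewrite -scalerAl -scalerAr a'a scalerA mulVf // scale1r.
- rewrite cnormZ ComplexField.Normc.normcV.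
  by apply: ler_wpM2l => //; rewrite invr_ge0 normc_ge0.
Qed.

Lemma bounded_inverse_le a M N :
  M <= N -> bounded_inverse a M -> bounded_inverse a N.
Proof. by move=> MN [b [? ? h]]; exists b; split => //; exact: le_trans h MN. Qed.

(** With b the inverse of a, a + e = a (1 + b e), and b e has norm at most
    1/2. *)
Lemma bounded_inverse_perturb a e M :
  bounded_inverse a M -> M * cnorm e <= 2^-1 -> bounded_inverse (a + e) (2 * M).
Proof.
move=> aM eM; have [b [ab ba bM]] := aM.
have be : cnorm (- (b * e)) <= 2^-1.
  rewrite cnormN; apply: le_trans (cnormM _ _) (le_trans _ eM).
  by apply: ler_wpM2r => //; exact: cnorm_ge0.
have -> : a + e = a * (1 - - (b * e)).
  by rewrite opprK mulrDr mulr1 mulrA ab mul1r.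
rewrite mulrC; apply: bounded_inverse_mul => //.
apply: bounded_inverse_le (neumann (le_lt_trans be _)); last by lra.
rewrite -[leRHS]invrK lef_pV2 ?posrE; lra.
Qed.

Lemma bounded_resolvent a l : cnorm a < normc l ->
  bounded_inverse (a - l%:A) (normc l - cnorm a)^-1.
Proof.
move=> al; have nl : 0 < normc l := le_lt_trans (cnorm_ge0 a) al.
have l0 : l != 0.
  by apply: contraTneq nl => ->; rewrite ComplexField.Normc.normc0 ltxx.
have -> : a - l%:A = - l *: (1 - l^-1 *: a).
  by rewrite scalerBr scalerA mulNr divff // scaleN1r opprK addrC scaleNr.
have nla : cnorm (l^-1 *: a) = (normc l)^-1 * cnorm a.
  by rewrite cnormZ ComplexField.Normc.normcV.
have -> : (normc l - cnorm a)^-1 = (normc (- l))^-1 * (1 - cnorm (l^-1 *: a))^-1.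
  rewrite nla normcN -invfM mulrBr mulr1 mulVKf //.
  by rewrite gt_eqF.
apply: bounded_inverse_scale; first by rewrite oppr_eq0.
by apply: neumann; rewrite nla ltr_pdivrMl // mulr1.
Qed.

Lemma spectrum_le_norm a l : spectrum a l -> normc l <= cnorm a.
Proof.
move=> sl; rewrite leNgt; apply/negP => /bounded_resolvent [b [? ? _]].
by apply: sl; exists b.
Qed.
End Norm.

(** * Resolvents of self-adjoint elements *)

Section SelfAdjoint.
Variables (R : realType) (A : cstarAlgType R).
Implicit Types (a b h : A) (l w : R[i]) (x t M : R).

Lemma normc_im t : normc (0 +i* t) = `|t|.
Proof. by rewrite /= expr0n add0r sqrtr_sqr. Qed.

Lemma starN a : star (- a) = - star a.
Proof. by rewrite -scaleN1r starZ rmorphN rmorph1 scaleN1r. Qed.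

Lemma selfadjointD a b : selfadjoint a -> selfadjoint b -> selfadjoint (a + b).
Proof. by rewrite /selfadjoint starD => -> ->. Qed.

Lemma selfadjointN a : selfadjoint a -> selfadjoint (- a).
Proof. by rewrite /selfadjoint starN => ->. Qed.

Lemma selfadjointZ x a : selfadjoint a -> selfadjoint (x%:C *: a).
Proof. by rewrite /selfadjoint starZ conjc_real => ->. Qed.

Lemma selfadjoint_scalar x : selfadjoint (x%:C%:A : A).
Proof. by apply: selfadjointZ; exact: star1. Qed.

Lemma cnorm_sqr h : selfadjoint h -> cnorm (h ^+ 2) = cnorm h ^+ 2.
Proof. by move=> hs; rewrite -cstar_identity hs. Qed.

Lemma selfadjointX h n : selfadjoint h -> selfadjoint (h ^+ n).
Proof.
move=> hs; elim: n => [|n IH]; first by rewrite expr0; exact: star1.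
by rewrite /selfadjoint exprS starM IH hs -exprSr exprS.
Qed.

(** Arens' trick: the cross terms cancel in (h + i t)^* (h + i t) = h^2 + t^2,
    so the norm of h + i t grows like |t| + O(1/|t|). *)
Lemma cnorm_shift_im h t : selfadjoint h ->
  cnorm (h + (0 +i* t)%:A) ^+ 2 <= cnorm h ^+ 2 + t ^+ 2.
Proof.
move=> hs; set c := 0 +i* t.
have cc : conjc c = - c by rewrite /c /=; apply/eqP; rewrite eq_complex /= oppr0 !eqxx.
have c2 : c * c = - (t ^+ 2)%:C.
  by apply/eqP; rewrite /c eq_complex /= !(mul0r, mulr0, addr0, sub0r, oppr0) expr2 !eqxx.
rewrite -cstar_identity starD hs starZ star1 cc scaleNr.
have -> : (h - c%:A) * (h + c%:A) = h ^+ 2 + (t ^+ 2)%:C%:A.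
  rewrite mulrBl !mulrDr mulr_algl -scalerAl -!scalerAr mulr1 mul1r scalerA c2.
  by rewrite opprD addrA addrK scaleNr opprK expr2.
apply: le_trans (cnormD _ _) _.
by rewrite cnorm_sqr // cnorm_scalar normc_real ger0_norm ?sqr_ge0.
Qed.

(** Write l = x + i b and H = h - x.  Then h - l = (H + i t) - i (b + t) for all
    real t; for t of the sign of b and large, |H + i t| is at most |t| + |b|/2,
    so that the Neumann series applies with margin |b|/2. *)
Lemma bounded_resolvent_nonreal h l : selfadjoint h -> complex.Im l != 0 ->
  bounded_inverse (h - l%:A) (2 / `|complex.Im l|).
Proof.
case: l => x b /= hs b0.
(* This t gives |t| |b| = |H|^2, the square-completion term in (|t| + |b|/2)^2. *)
pose H := h - x%:C%:A; pose t := cnorm H ^+ 2 / b.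
have Hs : selfadjoint H by apply: selfadjointD hs (selfadjointN (selfadjoint_scalar _)).
have -> : h - (x +i* b)%:A = (H + (0 +i* t)%:A) - (0 +i* (b + t))%:A.
  rewrite /H -!addrA; congr (_ + _); rewrite -!scaleNr -!scalerDl; congr (_ *: _).
  by apply/eqP; rewrite eq_complex /=; apply/andP; split; apply/eqP; ring.
have k0 := cnorm_ge0 H; have b1 : 0 < `|b| by rewrite normr_gt0.
have tb : `|t| * `|b| = cnorm H ^+ 2.
  by rewrite -normrM /t divfK // ger0_norm ?sqr_ge0.
have nbt : `|b + t| = `|b| + `|t|.
  have -> : b + t = b * (1 + cnorm H ^+ 2 / b ^+ 2) by rewrite /t; field.
  have -> : t = b * (cnorm H ^+ 2 / b ^+ 2) by rewrite /t; field.
  have q0 : 0 <= cnorm H ^+ 2 / b ^+ 2 by rewrite divr_ge0 ?sqr_ge0.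
  rewrite (normrM b (1 + _)) (normrM b (_ / _)) (ger0_norm q0).
  by rewrite (ger0_norm (addr_ge0 ler01 q0)) mulrDr mulr1.
have shift : cnorm (H + (0 +i* t)%:A) <= `|t| + `|b| / 2.
  rewrite -ler_sqr ?nnegrE ?cnorm_ge0 ?addr_ge0 ?divr_ge0 //.
  apply: le_trans (cnorm_shift_im t Hs) _.
  rewrite -tb -(real_normK (num_real t)).
  by move: (normr_ge0 t) (normr_ge0 b); set T := `|t|; set B := `|b|; nra.
have lt : cnorm (H + (0 +i* t)%:A) < normc (0 +i* (b + t)).
  by rewrite normc_im nbt; apply: le_lt_trans shift _; lra.
apply: bounded_inverse_le (bounded_resolvent lt).
rewrite -[leRHS]invrK lef_pV2 ?posrE ?subr_gt0 // ?invr_gt0 ?divr_gt0 //.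
by rewrite invf_div normc_im nbt; lra.
Qed.

(** Close to w = 1 and w = -1 the inverses are perturbations of those of 1 - h
    and 1 + h.  On the rest of the circle w stays away from the real axis, since
    1 - w^2 = -2 i w Im w, and the resolvent bound off the axis takes over.  This
    makes the bound uniform without a compactness argument. *)
Lemma bounded_inverse_circle h : selfadjoint h ->
  invertible (1 - h) -> invertible (1 + h) ->
  exists2 M, 0 < M & forall w, normc w = 1 -> bounded_inverse (1 - w *: h) M.
Proof.
move=> hs [u [u1 u2]] [v [v1 v2]].
pose k := cnorm h; pose K := cnorm u + cnorm v + k + 1.
have u0 := cnorm_ge0 u; have v0 := cnorm_ge0 v; have k0 : 0 <= k := cnorm_ge0 h.
have K1 : 1 <= K by rewrite /K; lra.
have iu : bounded_inverse (1 - h) K by exists u; split => //; rewrite /K; lra.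
have iv : bounded_inverse (1 + h) K by exists v; split => //; rewrite /K; lra.
(* 2 K bounds the inverse within 1 / (2 K^2) of w = 1 and w = -1, and 16 K^4
   elsewhere: there |1 - w^2| >= 1 / (4 K^4), so |Im w| >= 1 / (8 K^4). *)
exists (2 * K + 16 * K ^+ 4); first by nra.
move=> w w1.
have near1 : normc (1 - w) * (2 * K ^+ 2) <= 1 ->
    bounded_inverse (1 - w *: h) (2 * K + 16 * K ^+ 4).
  move=> hw; have -> : 1 - w *: h = (1 - h) + (1 - w) *: h.
    by rewrite scalerBl scale1r addrA subrK.
  apply: (@bounded_inverse_le _ _ _ (2 * K)); first by nra.
  apply: bounded_inverse_perturb => //; rewrite cnormZ -/k.
  have := normc_ge0 (1 - w); have : k <= K by rewrite /K; lra.
  by set n := normc _ in hw *; nra.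
have nearN1 : normc (1 + w) * (2 * K ^+ 2) <= 1 ->
    bounded_inverse (1 - w *: h) (2 * K + 16 * K ^+ 4).
  move=> hw; have -> : 1 - w *: h = (1 + h) + - ((1 + w) *: h).
    by rewrite scalerDl scale1r opprD addrA addrK.
  apply: (@bounded_inverse_le _ _ _ (2 * K)); first by nra.
  apply: bounded_inverse_perturb => //; rewrite cnormN cnormZ -/k.
  have := normc_ge0 (1 + w); have : k <= K by rewrite /K; lra.
  by set n := normc _ in hw *; nra.
have [/near1 //|f1] := leP (normc (1 - w) * (2 * K ^+ 2)) 1.
have [/nearN1 //|f2] := leP (normc (1 + w) * (2 * K ^+ 2)) 1.
have w0 : w != 0.
  by apply: contra_eq_neq w1 => ->; rewrite ComplexField.Normc.normc0 eq_sym oner_eq0.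
have -> : 1 - w *: h = (- w) *: (h - w^-1%:A).
  by rewrite scalerBr scalerA mulNr divff // scaleN1r opprK addrC scaleNr.
have far : 1 <= `|complex.Im w| * (8 * K ^+ 4).
  have : 1 <= normc ((1 - w) * (1 + w)) * (4 * K ^+ 4).
    rewrite ComplexField.Normc.normcM.
    set p := normc (1 - w) in f1 *; set q := normc (1 + w) in f2 *.
    have -> : p * q * (4 * K ^+ 4) = (p * (2 * K ^+ 2)) * (q * (2 * K ^+ 2)) by ring.
    by nra.
  have -> : (1 - w) * (1 + w) = (- w) * (0 +i* (2 * complex.Im w)).
    case: w w1 {w0 near1 nearN1 f1 f2} => x y /= hxy.
    have : x ^+ 2 + y ^+ 2 = 1 by rewrite -[LHS]sqr_sqrtr ?addr_ge0 ?sqr_ge0 // hxy expr1n.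
    move=> e; apply/eqP; rewrite eq_complex /=; apply/andP; split; apply/eqP; [|ring].
    by nra.
  rewrite ComplexField.Normc.normcM normcN w1 mul1r normc_im normrM ger0_norm //.
  by move/le_trans; apply; rewrite le_eqVlt; apply/orP; left; apply/eqP; ring.
have imV : `|complex.Im w^-1| = `|complex.Im w|.
  case: w w1 {w0 near1 nearN1 f1 f2 far} => x y /= hxy.
  have -> : x ^+ 2 + y ^+ 2 = 1 by rewrite -[LHS]sqr_sqrtr ?addr_ge0 ?sqr_ge0 // hxy expr1n.
  by rewrite divr1 normrN.
have im0 : 0 < `|complex.Im w|.
  by rewrite lt_neqAle normr_ge0 andbT; apply: contraTneq far => <-; rewrite mul0r ler10.
apply: (@bounded_inverse_le _ _ _ ((normc (- w))^-1 * (2 / `|complex.Im w^-1|))).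
  rewrite normcN w1 invr1 mul1r imV ler_pdivrMr //.
  by set i := `|_| in far im0 *; nra.
apply: bounded_inverse_scale; first by rewrite oppr_eq0.
by apply: bounded_resolvent_nonreal => //; rewrite -normr_gt0 imV.
Qed.
End SelfAdjoint.

(** * The norm of a self-adjoint element is attained on its spectrum *)

Section SpectralRadius.
Variables (R : realType) (A : cstarAlgType R).
Implicit Types (a h y z : A) (l w c : R[i]) (x e M : R).

Definition inverse_of a y := a * y = 1 /\ y * a = 1.

(** Partial fractions: 2 / (1 - a^2) = 1 / (1 - a) + 1 / (1 + a). *)
Lemma inverse_of_sub_sqr a y1 y2 :
  inverse_of (1 - a) y1 -> inverse_of (1 + a) y2 ->
  inverse_of (1 - a ^+ 2) (2^-1 *: (y1 + y2)).
Proof.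
move=> [r1 l1] [r2 l2].
have e1 : 1 - a ^+ 2 = (1 - a) * (1 + a).
  by rewrite mulrDr mulr1 mulrBl mul1r addrA subrK expr2.
have e2 : 1 - a ^+ 2 = (1 + a) * (1 - a).
  by rewrite mulrBr mulr1 mulrDl mul1r opprD addrA addrK expr2.
have two : 2^-1 *: ((1 + a) + (1 - a)) = 1 :> A.
  rewrite addrACA subrr addr0 -mulr2n -(scaler_nat 2 (1 : A)) scalerA mulVf ?scale1r ?pnatr_eq0 //.
split.
- rewrite -scalerAr mulrDr {1}e2 e1 -!mulrA r1 r2 !mulr1; exact: two.
- rewrite -scalerAl mulrDl {1}e1 e2 !mulrA l1 l2 !mul1r; exact: two.
Qed.

(** The quantification over the whole unit circle is what makes this property
    stable under squaring: a square root of w is again on the circle. *)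
Definition resolvent_gap a c e := forall w, normc w = 1 ->
  exists y z, [/\ inverse_of (1 - w *: a) y, inverse_of (1 - (c * w) *: a) z &
                  cnorm (z - y) <= e].

(** Averaging over the two square roots of w does not increase the gap e. *)
Lemma resolvent_gap_sqr a c e :
  resolvent_gap a c e -> resolvent_gap (a ^+ 2) (c ^+ 2) e.
Proof.
move=> gap w w1; pose s := sqrtc w.
have s2 : s ^+ 2 = w by rewrite sqr_sqrtc.
have s1 : normc s = 1.
  apply/eqP; rewrite -(@eqrXn2 _ 2) ?normc_ge0 //; apply/eqP.
  by rewrite expr1n -w1 -s2 !expr2 ComplexField.Normc.normcM.
have [y1 [z1 [iy1 iz1 d1]]] := gap s s1.
have sN1 : normc (- s) = 1 by rewrite normcN.
have [y2 [z2 [iy2 iz2 d2]]] := gap (- s) sN1.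
move: iy2 iz2; rewrite mulrN !scaleNr !opprK => iy2 iz2.
exists (2^-1 *: (y1 + y2)), (2^-1 *: (z1 + z2)); split.
- by rewrite -s2 -exprZn; exact: inverse_of_sub_sqr.
- by rewrite -s2 -exprMn -exprZn; exact: inverse_of_sub_sqr.
rewrite -scalerBr opprD addrACA.
have -> : 2^-1 = (2^-1 : R)%:C by rewrite fmorphV /= rmorph_nat.
rewrite cnormZr ger0_norm ?invr_ge0 //.
by apply: le_trans (ler_wpM2l _ (cnormD _ _)) _; rewrite ?invr_ge0 //; lra.
Qed.

Lemma resolvent_gap_pow a c e n :
  resolvent_gap a c e -> resolvent_gap (a ^+ (2 ^ n)) (c ^+ (2 ^ n)) e.
Proof.
move=> gap; elim: n => [|n IH]; first by rewrite !expn0 !expr1.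
by rewrite expnSr !exprM; exact: resolvent_gap_sqr.
Qed.

(** Resolvent identity: z - y = - z d y, where d = (1 - x) w h is the difference
    of the two elements inverted. *)
Lemma resolvent_gap_small h M x :
  cnorm h <= 1 -> 0 <= x <= 1 -> (1 - x) * M <= 2^-1 ->
  (forall w, normc w = 1 -> bounded_inverse (1 - w *: h) M) ->
  resolvent_gap h x%:C ((1 - x) * (2 * M ^+ 2)).
Proof.
move=> h1 /andP[x0 x1] xM bi w w1.
have [y [yr yl yM]] := bi w w1.
have n0 := cnorm_ge0 y; have nh := cnorm_ge0 h.
pose d := ((1 - x)%:C * w) *: h.
have nd : cnorm d <= 1 - x.
  rewrite cnormZ ComplexField.Normc.normcM w1 mulr1 normc_real ger0_norm ?subr_ge0 //.
  by rewrite ler_piMr ?subr_ge0.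
have dE : 1 - (x%:C * w) *: h = (1 - w *: h) + d.
  by rewrite /d rmorphB /= rmorph1 mulrBl mul1r scalerBl addrA subrK.
have [|z [zr zl zM]] := @bounded_inverse_perturb _ _ _ d M (bi w w1).
  by apply: le_trans xM; rewrite mulrC; apply: ler_wpM2r nd; lra.
exists y, z; rewrite dE; split => //.
have -> : z - y = - (z * d * y).
  have -> : d = ((1 - w *: h) + d) - (1 - w *: h) by rewrite addrAC subrr add0r.
  by rewrite mulrBr mulrBl zl mul1r -mulrA yr mulr1 opprB.
rewrite cnormN; apply: le_trans (cnormM _ _) _.
apply: (@le_trans _ _ ((cnorm z * cnorm d) * cnorm y)).
  by apply: ler_wpM2r => //; exact: cnormM.
have -> : (1 - x) * (2 * M ^+ 2) = ((2 * M) * (1 - x)) * M by ring.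
apply: ler_pM => //; first by rewrite mulr_ge0 ?cnorm_ge0.
by apply: ler_pM => //; exact: cnorm_ge0.
Qed.

(** If x is small then the inverse of 1 - x a is close to 1, hence so is the
    inverse y of 1 - a; then a = (1 - a) (y - 1) has norm below 1. *)
Lemma resolvent_gap_norm a x :
  0 <= x <= 16^-1 -> cnorm a = 1 -> ~ resolvent_gap a x%:C 16^-1.
Proof.
move=> /andP[x0 x1] a1 gap.
have [y [z [[yr yl] [zr zl] zy]]] := gap 1 (ComplexField.Normc.normc1 _).
move: yr yl zr zl; rewrite mulr1 scale1r => yr yl zr zl.
have nz0 := cnorm_ge0 z.
have zE : z - 1 = (x%:C *: a) * z.
  by rewrite -[in LHS]zr mulrBl mul1r opprB addrC subrK.
have z1 : cnorm (z - 1) <= x * cnorm z.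
  by rewrite zE; apply: le_trans (cnormM _ _) _; rewrite cnormZr a1 mulr1 ger0_norm.
have z2 : cnorm z <= cnorm (z - 1) + 1.
  by have := cnormD (z - 1) 1; rewrite subrK cnorm1.
have y1 : cnorm (y - 1) <= 4^-1.
  have -> : y - 1 = (z - 1) - (z - y) by rewrite opprB [RHS]addrC addrA subrK.
  apply: le_trans (cnormB _ _) _; nra.
have aE : a = (1 - a) * (y - 1) by rewrite mulrBr yr mulr1 opprB addrC subrK.
have : cnorm a <= 2 * 4^-1.
  rewrite {1}aE; apply: le_trans (cnormM _ _) _.
  apply: ler_pM => //; try exact: cnorm_ge0.
  by apply: le_trans (cnormB _ _) _; rewrite cnorm1 a1.
by rewrite a1; lra.
Qed.

(** For self-adjoint elements the C*-identity reads |h^2| = |h|^2. *)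
Lemma cnorm_pow2 h n : selfadjoint h -> cnorm h = 1 -> cnorm (h ^+ (2 ^ n)) = 1.
Proof.
move=> hs h1; elim: n => [|n IH]; first by rewrite expn0 expr1.
by rewrite expnSr exprM cnorm_sqr ?IH ?expr1n //; exact: selfadjointX.
Qed.

Lemma norm1_not_invertible h : selfadjoint h -> cnorm h = 1 ->
  invertible (1 - h) -> invertible (1 + h) -> False.
Proof.
move=> hs h1 i1 i2.
have [M M0 bi] := bounded_inverse_circle hs i1 i2.
(* With 1 - x = 1/D, both (1 - x) M <= 1/2 and (1 - x) 2 M^2 <= 1/16. *)
pose D := 2 * M + 32 * M ^+ 2 + 1; pose x := 1 - D^-1.
have D1 : 1 <= D by rewrite /D; nra.
have DV : 0 < D^-1 <= 1 by rewrite invr_gt0 invf_le1; lra.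
have DD : D^-1 * D = 1 by rewrite mulVf //; lra.
have x01 : 0 <= x <= 1 by rewrite /x; lra.
have gap : resolvent_gap h x%:C 16^-1.
  have h1' : cnorm h <= 1 by rewrite h1.
  have xM : (1 - x) * M <= 2^-1.
    by move: DV DD; rewrite /x /D; set v := _^-1 => *; nra.
  move=> w w1; have [y [z [iy iz d]]] := resolvent_gap_small h1' x01 xM bi w1.
  exists y, z; split => //; apply: le_trans d _.
  by move: DV DD; rewrite /x /D; set v := _^-1 => *; nra.
have x1 : `|x| < 1 by rewrite ger0_norm /x; lra.
have s0 : (0 : R) < 16^-1 by rewrite invr_gt0.
have /cvgr0Pnorm_lt /(_ _ s0) [n _ hn] := cvg_expr x1.
have xn : 0 <= x ^+ (2 ^ n) <= 16^-1.
  rewrite exprn_ge0 ?andbT /=; last by case/andP: x01.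
  apply: le_trans (ltW (hn n (leqnn n))) => /=.
  rewrite ger0_norm ?exprn_ge0 //; last by case/andP: x01.
  by apply: ler_wiXn2l; [case/andP: x01 | case/andP: x01 | exact: ltnW (ltn_expl _ _)].
apply: (resolvent_gap_norm xn (cnorm_pow2 n hs h1)).
by rewrite rmorphXn; exact: resolvent_gap_pow.
Qed.

(** The spectral radius formula for self-adjoint elements, in the sharp form
    that their real spectrum allows. *)
Lemma selfadjoint_spectrum_norm h : selfadjoint h ->
  spectrum h (cnorm h)%:C \/ spectrum h (- cnorm h)%:C.
Proof.
move=> hs; apply: contrapT => /not_orP[/contrapT i1 /contrapT i2].
have [h0|h0] := pselect (h = 0).
  case: i1 => b []; rewrite h0 cnorm0 scale0r subrr mul0r => /eqP.
  by rewrite eq_sym oner_eq0.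
have n0 := cnorm_gt0 h0; set n := cnorm h in n0 i1 i2.
have invZ c a : c != 0 -> invertible a -> invertible (c *: a).
  move=> c0 [b [r l]]; exists (c^-1 *: b).
  by rewrite -!scalerAl -!scalerAr r l !scalerA divff // mulVf // scale1r.
have nC : n%:C != 0 :> R[i] by rewrite (inj_eq (@complexI _)) gt_eqF.
have gs := selfadjointZ n^-1 hs.
apply: (norm1_not_invertible gs).
- by rewrite cnormZr ger0_norm ?invr_ge0 ?ltW // mulVf // gt_eqF.
- have -> : 1 - n^-1%:C *: h = (- n^-1%:C) *: (h - n%:C%:A).
    by rewrite scalerBr scalerA mulNr fmorphV mulVf // scaleN1r opprK addrC scaleNr.
  by apply: invZ => //; rewrite oppr_eq0 fmorphV invr_eq0.
- have -> : 1 + n^-1%:C *: h = n^-1%:C *: (h - (- n)%:C%:A).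
    by rewrite scalerBr scalerA rmorphN mulrN fmorphV mulVf // scaleN1r opprK addrC.
  by apply: invZ => //; rewrite fmorphV invr_eq0.
Qed.
End SpectralRadius.

(** * Positive elements and monotonicity of the norm *)

Section Positive.
Variables (R : realType) (A : cstarAlgType R).
Implicit Types (a b p q : A) (l : R[i]) (x t : R).

Lemma spectrum_reflect m a l : spectrum a l -> spectrum (m%:A - a) (m - l).
Proof.
move=> sl [b [r i]]; apply: sl; exists (- b).
have e : m%:A - a - (m - l)%:A = - (a - l%:A).
  by rewrite scalerBl !opprB [LHS]addrC addrA subrK.
by rewrite mulrN mulNr -mulNr -mulrN -e r i.
Qed.

(** The value -|p| is excluded by positivity, unless p = 0. *)
Lemma cpos_spectrum_norm p : cpos p -> spectrum p (cnorm p)%:C.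
Proof.
move=> [ps pp]; have [//|h] := selfadjoint_spectrum_norm ps.
have := pp _ h; rewrite /= lecR oppr_ge0 => n0.
have e : cnorm p = 0 by apply/eqP; rewrite eq_le n0 cnorm_ge0.
by move: h; rewrite e oppr0.
Qed.

(** A reformulation of positivity by norms: unlike the condition on the
    spectrum, it is evidently stable under sums. *)
Definition ball_positive a :=
  selfadjoint a /\ exists t, cnorm (t%:C%:A - a) <= t.

(** With m = |p| and h = m - p, one of |h| and -|h| is in the spectrum of h, so
    m - |h| or m + |h| is in that of p.  The first must be nonnegative, and the
    second at most m, so |h| <= m in either case. *)
Lemma cpos_ball_positive p : cpos p -> ball_positive p.
Proof.
move=> [ps pp]; split => //; set m := cnorm p; exists m.
have m0 : 0 <= m := cnorm_ge0 p.
set h := m%:C%:A - p; have hs : selfadjoint h.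
  by apply: selfadjointD (selfadjoint_scalar _ _) (selfadjointN ps).
have pE : p = m%:C%:A - h by rewrite /h opprB addrC subrK.
rewrite leNgt; apply/negP => mn.
have [/(@spectrum_reflect m%:C _ _)|/(@spectrum_reflect m%:C _ _)] := selfadjoint_spectrum_norm hs.
  by rewrite -pE -rmorphB => /pp; rewrite /= lecR; lra.
rewrite -pE -rmorphB => /spectrum_le_norm; rewrite normc_real -/m ger0_norm; lra.
Qed.

Lemma ball_positiveD a b : ball_positive a -> ball_positive b -> ball_positive (a + b).
Proof.
move=> [sa [s hs]] [sb [t ht]]; split; first exact: selfadjointD.
exists (s + t); rewrite rmorphD scalerDl opprD addrACA.
by apply: le_trans (cnormD _ _) _; exact: lerD.
Qed.

Lemma ball_positive_norm a : selfadjoint a -> ball_positive ((cnorm a)%:C%:A - a).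
Proof.
move=> hs; split; first exact: selfadjointD (selfadjoint_scalar _ _) (selfadjointN hs).
by exists (cnorm a); rewrite opprB addrC subrK.
Qed.

Lemma ball_positive_spectrum a x : ball_positive a -> spectrum a x%:C -> 0 <= x.
Proof.
move=> [_ [t ht]] /(@spectrum_reflect t%:C _ _); rewrite -rmorphB => /spectrum_le_norm.
by rewrite normc_real => /le_trans /(_ ht); rewrite ler_norml; lra.
Qed.

(** Monotonicity of the norm, obtained from the decomposition
    |p + q| - p = (|p + q| - (p + q)) + q into ball-positive elements and from
    |p| being a spectral value of p. *)
Lemma cnorm_le_add p q : cpos p -> ball_positive q -> cnorm p <= cnorm (p + q).
Proof.
move=> pp qp; have ws : selfadjoint (p + q) := selfadjointD pp.1 qp.1.
have := ball_positiveD (ball_positive_norm ws) qp.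
set n := cnorm _; rewrite opprD addrA subrK => np.
have := spectrum_reflect (m := n%:C) (cpos_spectrum_norm pp); rewrite -rmorphB.
by move/(ball_positive_spectrum np); rewrite subr_ge0.
Qed.

Lemma cnorm_star a : cnorm (star a) = cnorm a.
Proof.
suff le b : cnorm b <= cnorm (star b).
  by apply/eqP; rewrite eq_le le andbT; have := le (star a); rewrite starK.
have [b0|b0] := pselect (b = 0); first by rewrite b0 cnorm0 cnorm_ge0.
by rewrite -(ler_pM2r (cnorm_gt0 b0)) -expr2 -cstar_identity cnormM.
Qed.

(** By monotonicity |p| <= |b^* p b| <= |b|^2 |p|. *)
Lemma contraction_eq0 b p q : cpos p -> ball_positive q -> cnorm b < 1 ->
  p + q = star b * p * b -> p = 0.
Proof.
move=> pp qp b1 e; apply: contrapT => /cnorm_gt0 p0.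
have := cnorm_le_add pp qp; rewrite e; apply/negP; rewrite -ltNge.
have b0 := cnorm_ge0 b.
apply: le_lt_trans (cnormM _ _) _.
apply: (@le_lt_trans _ _ (cnorm b * cnorm p * cnorm b)).
  by apply: ler_wpM2r => //; rewrite -(cnorm_star b) cnormM.
apply: (@le_lt_trans _ _ (cnorm b * cnorm p)); last by rewrite gtr_pMl.
by rewrite ler_piMr ?mulr_ge0 ?cnorm_ge0 // ltW.
Qed.

Lemma contraction_le_eq0 b p : cpos p -> cnorm b < 1 ->
  p ⪯ star b * p * b -> p = 0.
Proof.
move=> pp b1 [_ _ /cpos_ball_positive qp].
by apply: (contraction_eq0 pp qp b1); rewrite addrC subrK.
Qed.
End Positive.

(** * The fixed circle *)

Theorem theorem11 (R : realType) (A : cstarAlgType R) (X : Type)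
    (d : X -> X -> A) (hd : cstar_metric d)
    (x0 : X) (r : A) (hr : cpos r)
    (phi : X -> A) (hphi : forall x, phi x = d x x0)
    (T : X -> X)
    (hB : exists b : A, cnorm b < 1 /\
      forall x, circle d x0 r x ->
        d x (T x) ⪯ phi x - phi (T x) /\
        r ⪯ star b * d x (T x) * b + d (T x) x0)
    (hA : exists a : A, cnorm a < 1 /\
      forall x y, circle d x0 r x -> ~ circle d x0 r y ->
        exists u : A,
          u \in [:: d x y; d x (T x); d y (T y); d x (T y); d y (T x)] /\
          d (T x) (T y) ⪯ star a * u * a) :
  fixed_circle d T x0 r /\
  (circle d x0 r !=set0 ->
   forall (x1 : X) (s : A), cpos s -> fixed_circle d T x1 s ->
     circle d x1 s `<=` circle d x0 r).
Proof.
have fixed : fixed_circle d T x0 r.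
  move: hB => [b [b1 hb]] x xr; have [[_ _ q1] [_ _ q2]] := hb x xr.
  symmetry; apply/(cmetric_eq0 hd).
  apply: (contraction_eq0 (cmetric_pos hd _ _) _ b1).
    exact: ball_positiveD (cpos_ball_positive q1) (cpos_ball_positive q2).
  rewrite !hphi xr addrA [d x (T x) + _]addrC subrK.
  by rewrite [_ + d (T x) x0]addrC !addrA subrK addrAC subrr add0r.
split=> // -[x xr] x1 s _ sfix y ys; apply: contrapT => yr.
move: hA => [a [a1 ha]]; have [u []] := ha x y xr yr.
rewrite (fixed x xr) (sfix y ys) (cmetric_sym hd y x) => uin le.
have neq : d x y <> 0 by move/(cmetric_eq0 hd) => e; apply: yr; rewrite -e.
apply: neq; have pxy := cmetric_pos hd x y.
have dd z : d z z = 0 by apply/(cmetric_eq0 hd).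
move: uin; rewrite !dd !inE => /or4P[||| /orP[]] /eqP ue; move: le; rewrite ue.
- exact: contraction_le_eq0.
(* Here u = 0, and d(x, y) <= 0 is the contraction condition with factor 0. *)
- rewrite mulr0 mul0r => le.
  apply: (@contraction_le_eq0 _ _ 0) => //; first by rewrite cnorm0.
  by rewrite mulr0.
- rewrite mulr0 mul0r => le.
  apply: (@contraction_le_eq0 _ _ 0) => //; first by rewrite cnorm0.
  by rewrite mulr0.
- exact: contraction_le_eq0.
- exact: contraction_le_eq0.
Qed.
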